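(* Let $P\subset\mathbb{R}^{d_1}$ be a polytope with vertices $v_1,\dots,v_n$, and let $Q_1,\dots,Q_n\subset\mathbb{R}^{d_2}$ be polytopes. Define $$P[Q_1,\dots,Q_n]=\mathrm{conv}\left(\bigcup_{i=1}^n\{v_i\}\times Q_i\right)\subset\mathbb{R}^{d_1+d_2}.$$ If the polytopes $P,Q_1,\dots,Q_n$ are minimal covering and $P[Q_1,\dots,Q_n]$ is covering, then $P[Q_1,\dots,Q_n]$ is minimal covering.
   Context: A convex body in $\mathbb{R}^d$ is a non-empty compact convex set. A convex body $K\subset\mathbb{R}^d$ is covering if $K+\mathbb{Z}^d=\mathbb{R}^d$ (with $d$ the dimension of the ambient space, so here $d=d_1$, $d_2$ or $d_1+d_2$), and minimal covering if it is covering and no convex body $K'\subsetneq K$ is covering. *)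

(* Defs.v *)
(* R^d is the type of row vectors (1 x d matrices) with its sup-norm topology. *)
From mathcomp Require Import all_boot all_order all_algebra.
From mathcomp Require Import all_classical all_reals all_analysis.

Set Implicit Arguments.
Unset Strict Implicit.
Unset Printing Implicit Defensive.

Import Order.TTheory GRing.Theory Num.Theory.
Import numFieldNormedType.Exports.

Local Open Scope classical_set_scope.
Local Open Scope ring_scope.

Definition convex_body (R : realType) (d : nat) (K : set 'rV[R]_d) : Prop :=
  [/\ K !=set0, compact K & @convex_set R 'rV[R]_d K].

Definition int_lattice (R : realType) (d : nat) : set 'rV[R]_d :=
  range (fun z : 'rV[int]_d => map_mx intr z).

Definition covering (R : realType) (d : nat) (K : set 'rV[R]_d) : Prop :=
  [set x + z | x in K & z in @int_lattice R d] = setT.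

Definition minimal_covering (R : realType) (d : nat) (K : set 'rV[R]_d) : Prop :=
  [/\ convex_body K, covering K &
      forall K' : set 'rV[R]_d, convex_body K' -> K' `<` K -> ~ covering K'].

Definition convex_hull (R : realType) (d : nat) (A : set 'rV[R]_d) :
    set 'rV[R]_d :=
  smallest (@convex_set R 'rV[R]_d) A.

Definition polytope (R : realType) (d : nat) (P : set 'rV[R]_d) : Prop :=
  exists2 A : set 'rV[R]_d, finite_set A & P = convex_hull A.

(* The vertices of a polytope are its extreme points. *)
Definition vertices (R : realType) (d : nat) (P : set 'rV[R]_d) :
    set 'rV[R]_d :=
  [set v | P v /\ forall (x y : 'rV[R]_d) (t : R), P x -> P y ->
     0 < t -> t < 1 -> v = t *: x + (1 - t) *: y -> x = v /\ y = v].

(* P[Q_1, ..., Q_n]; it depends on P only through the enumeration v of its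
   vertices. The pair (x, y) in R^d1 x R^d2 is row_mx x y in R^(d1 + d2). *)
Definition polytope_join (R : realType) (d1 d2 n : nat)
    (v : 'I_n -> 'rV[R]_d1) (Q : 'I_n -> set 'rV[R]_d2) :
    set 'rV[R]_(d1 + d2) :=
  convex_hull (\bigcup_i [set row_mx (v i) q | q in Q i]).

(* Main.v *)
(* Suppose K is a convex body properly contained in P[Q_1, ..., Q_n] that is
   covering. For some i the fibre of K over v_i is a proper convex part of Q_i,
   hence not covering, so some y0 has no lattice translate in that fibre. The
   horizontal slices of K at the heights y0 - z, for z integral, then lie in P,
   together cover R^d1 modulo Z^d1 and avoid v_i. Only finitely many of them are
   non-empty, so the convex hull of their union is compact; it still avoids v_i,
   since P minus an extreme point is convex. This contradicts the minimality of
   P. *)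
Require Import Defs.
From mathcomp Require Import all_boot all_order all_algebra.
From mathcomp Require Import all_classical all_reals all_analysis.
From mathcomp Require Import ring lra zify.

Set Implicit Arguments.
Unset Strict Implicit.
Unset Printing Implicit Defensive.

Import Order.TTheory GRing.Theory Num.Theory.
Import numFieldNormedType.Exports.

Local Open Scope classical_set_scope.
Local Open Scope ring_scope.

(** * Convex sets and convex hulls *)

Lemma convex_setP (R : realType) (M : lmodType R) (A : set M) :
  @convex_set R M A <-> forall (x y : M) (t : R), 0 < t -> t < 1 ->
    A x -> A y -> A (t *: x + (1 - t) *: y).
Proof.
split=> [/convex_setW cA x y t t0 t1 Ax Ay|cA].
  have := cA x y; rewrite !inE => /(_ Ax Ay (Itv01 (ltW t0) (ltW t1)) t0 t1).
  by rewrite inE.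
apply/convex_setW => x y; rewrite !inE => Ax Ay t t0 t1.
by rewrite inE; exact: cA.
Qed.

(** For positive weights [z] is the average of [x] and [y] with weights [s / (s + t)] and
    [t / (s + t)]. If a weight vanishes, [z] is the other point, which also settles [s = t = 0]
    without a division. *)
Lemma convex_conic_sum (R : realType) (M : lmodType R) (A : set M)
    (s t : R) (x y : M) :
  @convex_set R M A -> 0 <= s -> 0 <= t -> A x -> A y ->
  exists2 z, A z & s *: x + t *: y = (s + t) *: z.
Proof.
move=> /convex_setP cA; rewrite !le_eqVlt => /predU1P[<- _|s0].
  by exists y => //; rewrite scale0r !add0r.
move=> /predU1P[<-|t0] Ax Ay; first by exists x; rewrite // scale0r !addr0.
have st0 : 0 < s + t by rewrite addr_gt0.
exists ((s / (s + t)) *: x + (1 - s / (s + t)) *: y).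
  by apply: cA => //; rewrite ?divr_gt0// ltr_pdivrMr// mul1r ltrDl.
rewrite scalerDr !scalerA; congr (_ *: _ + _ *: _); field; lra.
Qed.

Lemma convex_hull_convex (R : realType) (d : nat) (A : set 'rV[R]_d) :
  @convex_set R 'rV[R]_d (convex_hull A).
Proof.
apply/convex_setP => x y t t0 t1 Ax Ay C [cC AC].
by move/convex_setP : (cC); apply => //; [exact: Ax|exact: Ay].
Qed.

Lemma sub_convex_hull (R : realType) (d : nat) (A : set 'rV[R]_d) :
  A `<=` convex_hull A.
Proof. exact: sub_gen_smallest. Qed.

Lemma convex_hull_sub (R : realType) (d : nat) (A C : set 'rV[R]_d) :
  @convex_set R 'rV[R]_d C -> A `<=` C -> convex_hull A `<=` C.
Proof. exact: smallest_sub. Qed.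

Lemma convex_hull_id (R : realType) (d : nat) (A : set 'rV[R]_d) :
  @convex_set R 'rV[R]_d A -> convex_hull A = A.
Proof. exact: smallest_id. Qed.

(** This lets the hull of a finite union be built by adding one set at a time. *)
Lemma convex_hull_setUr (R : realType) (d : nat) (A B : set 'rV[R]_d) :
  convex_hull (A `|` convex_hull B) = convex_hull (A `|` B).
Proof.
apply/seteqP; split; apply: convex_hull_sub; do ?exact: convex_hull_convex.
  rewrite subUset; split=> [x Ax|]; first by apply: sub_convex_hull; left.
  apply: convex_hull_sub; first exact: convex_hull_convex.
  by move=> x Bx; apply: sub_convex_hull; right.
apply: subset_trans (@sub_convex_hull _ _ _).
exact: setUS (@sub_convex_hull _ _ _).
Qed.

(** The segments joining [A] to [B] already form a convex set. Non-emptiness provides the second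
    endpoint when a point of [A] or [B] is seen as lying on such a segment. *)
Lemma convex_hull_setU (R : realType) (d : nat) (A B : set 'rV[R]_d) :
  A !=set0 -> B !=set0 ->
  @convex_set R 'rV[R]_d A -> @convex_set R 'rV[R]_d B ->
  convex_hull (A `|` B) =
  [set p.2 *: p.1.1 + (1 - p.2) *: p.1.2 | p in (A `*` B) `*` `[0, 1]].
Proof.
move=> [a0 Aa0] [b0 Bb0] cA cB; apply/seteqP; split.
  apply: convex_hull_sub.
    apply/convex_setP => x y t t0 t1 [[[a b] s] [[/= Aa Bb] + ] <-{x}].
    rewrite in_itv/= => /andP[s0 s1] [[[a' b'] s'] [[/= Aa' Bb'] + ] <-{y}].
    rewrite in_itv/= => /andP[s'0 s'1].
    (* The [A]-parts and the [B]-parts of the two points are merged separately; the weights of the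
       merged points again add up to 1. *)
    have [||a'' Aa'' ea] := convex_conic_sum cA _ _ Aa Aa' (s := t * s)
      (t := (1 - t) * s'); [nra|nra|].
    have [||b'' Bb'' eb] := convex_conic_sum cB _ _ Bb Bb' (s := t * (1 - s))
      (t := (1 - t) * (1 - s')); [nra|nra|].
    exists ((a'', b''), t * s + (1 - t) * s') => /=.
      by split=> //=; rewrite in_itv/=; nra.
    rewrite (_ : 1 - (_ + _) = t * (1 - s) + (1 - t) * (1 - s')); last by ring.
    by rewrite -ea -eb !scalerDr !scalerA addrACA.
  move=> x [Ax|Bx].
    exists ((x, b0), 1); first by split=> //=; rewrite in_itv/= ler01 lexx.
    by rewrite /= scale1r subrr scale0r addr0.
  exists ((a0, x), 0); first by split=> //=; rewrite in_itv/= ler01 lexx.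
  by rewrite /= scale0r subr0 scale1r add0r.
move=> _ [[[a b] t] [[/= Aa Bb] +] <-] C [/convex_setP cC ABC] /=.
have Ca : C a by apply: ABC; left.
have Cb : C b by apply: ABC; right.
rewrite in_itv/= => /andP[]; rewrite !le_eqVlt => /predU1P[<- _|t0].
  by rewrite scale0r subr0 scale1r add0r.
move=> /predU1P[->|t1]; last exact: cC.
by rewrite scale1r subrr scale0r addr0.
Qed.

(** * Compactness of hulls of finite unions *)

Lemma compact_convex_hull_setU (R : realType) (d : nat) (A B : set 'rV[R]_d) :
  A !=set0 -> B !=set0 ->
  @convex_set R 'rV[R]_d A -> @convex_set R 'rV[R]_d B ->
  compact A -> compact B -> compact (convex_hull (A `|` B)).
Proof.
move=> A0 B0 cA cB kA kB; rewrite convex_hull_setU//.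
(* The hull is the continuous image of the compact set [A * B * [0, 1]]. *)
apply: continuous_compact; last first.
  by do !apply: compact_setX => //; exact: segment_compact.
apply: continuous_subspaceT => -[[a b] t].
have fstC : (p : 'rV[R]_d * 'rV[R]_d * R).1 @[p --> (a, b, t)] --> (a, b).
  exact: cvg_fst.
have sndC : (p : 'rV[R]_d * 'rV[R]_d * R).2 @[p --> (a, b, t)] --> t.
  exact: cvg_snd.
apply: cvgD; apply: cvgZ => //.
- by apply: cvg_comp fstC _; exact: cvg_fst.
- by apply: cvgB => //; exact: cvg_cst.
- by apply: cvg_comp fstC _; exact: cvg_snd.
Qed.

(** Induction on the finite index set: the hull of the remaining sets is itself compact and convex,
    so the case of two sets applies. Empty sets are treated apart, since that case asks for
    non-empty ones. *)
Lemma compact_convex_hull_bigcup (R : realType) (d : nat) (I : choiceType)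
    (D : set I) (F : I -> set 'rV[R]_d) :
  finite_set D -> (forall i, D i -> compact (F i)) ->
  (forall i, D i -> @convex_set R 'rV[R]_d (F i)) ->
  compact (convex_hull (\bigcup_(i in D) F i)).
Proof.
move=> /finite_seqP[s ->]; elim: s => [|i s IH] kF cF.
  rewrite set_nil bigcup_set0 convex_hull_id; first exact: compact0.
  by apply/convex_setP.
rewrite (_ : [set` i :: s] = i |` [set` s]); last first.
  by apply/seteqP; split=> j /=; rewrite inE => /predU1P.
rewrite bigcup_setU1 -convex_hull_setUr.
have [kFi cFi] : compact (F i) /\ @convex_set R 'rV[R]_d (F i).
  by split; [apply: kF|apply: cF] => /=; rewrite mem_head.
have {IH} kU : compact (convex_hull (\bigcup_(j in [set` s]) F j)).
  by apply: IH => j js; [apply: kF|apply: cF]; rewrite /= inE js orbT.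
have cU := @convex_hull_convex _ _ (\bigcup_(j in [set` s]) F j).
have [->|/set0P Fi0] := eqVneq (F i) set0; first by rewrite set0U convex_hull_id.
have [->|/set0P U0] := eqVneq (convex_hull (\bigcup_(j in [set` s]) F j)) set0.
  by rewrite setU0 convex_hull_id.
exact: compact_convex_hull_setU.
Qed.

(** * Continuity of block operations *)

Lemma continuous_mx (T : topologicalType) (U : topologicalType) (m n : nat)
    (f : T -> 'M[U]_(m, n)) :
  (forall i j, continuous (fun x => f x i j)) -> continuous f.
Proof.
move=> cf x A [P nP PA].
suff : \forall y \near x, forall i j, P i j (f y i j).
  by apply: filterS => y Py; exact: PA.
by apply: filter_forall => i; apply: filter_forall => j; exact: cf (nP i j).
Qed.

Lemma row_mx_continuousl (R : realType) (d1 d2 : nat) (y : 'rV[R]_d2) :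
  continuous (fun x : 'rV[R]_d1 => row_mx x y).
Proof.
apply: continuous_mx => i j; case: (split_ordP j) => k ->.
  by under eq_fun do rewrite row_mxEl; exact: coord_continuous.
by under eq_fun do rewrite row_mxEr; exact: cst_continuous.
Qed.

Lemma row_mx_continuousr (R : realType) (d1 d2 : nat) (x : 'rV[R]_d1) :
  continuous (fun y : 'rV[R]_d2 => row_mx x y).
Proof.
apply: continuous_mx => i j; case: (split_ordP j) => k ->.
  by under eq_fun do rewrite row_mxEl; exact: cst_continuous.
by under eq_fun do rewrite row_mxEr; exact: coord_continuous.
Qed.

(** * Lattice points in bounded sets *)

Lemma ler_entry_norm (R : realType) (m n : nat) (A : 'M[R]_(m, n)) i j :
  `|A i j| <= `|A|.
Proof.
rewrite [leRHS]mx_normrE.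
exact: (le_bigmax _ (fun ij : 'I_m * 'I_n => `|A ij.1 ij.2|) (i, j)).
Qed.

Lemma finite_bounded_int_mx (R : realType) (m n : nat) (M : R) :
  finite_set [set z : 'M[int]_(m, n) | forall i j, `|(z i j)%:~R| <= M].
Proof.
pose N := (Num.trunc M).+1.
(* Shifting the values 0, ..., 2N by [N] reaches every matrix with entries in [-N, N], and [N]
   exceeds [M]. *)
pose dec (f : {ffun 'I_m * 'I_n -> 'I_(N + N).+1}) : 'M[int]_(m, n) :=
  \matrix_(i, j) ((f (i, j))%:Z - N%:Z).
apply: (@sub_finite_set _ _ (range dec)); last first.
  exact: finite_image finite_finset.
move=> z zM; exists [ffun ij => inord (absz (z ij.1 ij.2 + N%:Z))] => //.
apply/matrixP => i j; rewrite mxE ffunE/=.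
have zN : `|z i j| < N%:Z.
  rewrite -(ltr_int R) intr_norm; apply: le_lt_trans (zM i j) _.
  exact: truncnS_gt.
by rewrite inordK; lia.
Qed.

Lemma finite_lattice_translates (R : realType) (d : nat) (K : set 'rV[R]_d)
    (y : 'rV[R]_d) :
  compact K -> finite_set [set z : 'rV[int]_d | K (y - map_mx intr z)].
Proof.
move=> /compact_bounded[M [_ KM]].
(* Boundedness gives a norm bound for each real strictly above [M]; [M + 1] is one of them. *)
apply: sub_finite_set (finite_bounded_int_mx 1 d (`|y| + (M + 1))) => z /= Kz i j.
have -> : (z i j)%:~R = (y - (y - map_mx intr z)) i j :> R.
  by rewrite subKr mxE.
apply: le_trans (ler_entry_norm _ _ _) _; apply: le_trans (ler_normB _ _) _.
by rewrite lerD2l; apply: KM Kz; rewrite ltrDl.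
Qed.

(** * Coverings, vertices and fibres of the join *)

Lemma coveringP (R : realType) (d : nat) (K : set 'rV[R]_d) :
  covering K <-> forall x, exists z : 'rV[int]_d, K (x - map_mx intr z).
Proof.
split=> [cK x|cK].
  have : [set: 'rV[R]_d] x by [].
  by rewrite -cK => -[y Ky [_ [z _ <-]] <-]; exists z; rewrite addrK.
apply/seteqP; split=> // x _; have [z Kz] := cK x.
exists (x - map_mx intr z) => //; exists (map_mx intr z); first by exists z.
by rewrite subrK.
Qed.

Lemma convex_setD1_vertex (R : realType) (d : nat) (P : set 'rV[R]_d) v :
  @convex_set R 'rV[R]_d P -> vertices P v ->
  @convex_set R 'rV[R]_d (P `\ v).
Proof.
move=> /convex_setP cP [_ ext]; apply/convex_setP => x y t t0 t1 [Px xv] [Py yv].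
split=> [|/= e]; first exact: cP.
by have [] := ext x y t Px Py t0 t1 (esym e).
Qed.

(** The two conditions define a convex set [C]: a point strictly inside a segment can lie over the
    vertex [v i] only if both endpoints do, and then convexity of [Q i] applies. Injectivity of [v]
    places the generators in [C]. *)
Lemma polytope_join_sub (R : realType) (d1 d2 n : nat)
    (P : set 'rV[R]_d1) (v : 'I_n -> 'rV[R]_d1) (Q : 'I_n -> set 'rV[R]_d2) :
  @convex_set R 'rV[R]_d1 P -> injective v -> (forall i, vertices P (v i)) ->
  (forall i, @convex_set R 'rV[R]_d2 (Q i)) ->
  forall x y, polytope_join v Q (row_mx x y) ->
    P x /\ forall i, x = v i -> Q i y.
Proof.
move=> cP v_inj vP cQ x y.
pose C := [set p : 'rV[R]_(d1 + d2) |
  P (lsubmx p) /\ forall i, lsubmx p = v i -> Q i (rsubmx p)].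
suff : polytope_join v Q `<=` C by move=> /[apply]; rewrite /C/= row_mxKl row_mxKr.
apply: convex_hull_sub; last first.
  move=> _ [i _ [q Qq <-]]; rewrite /C/= row_mxKl row_mxKr; split.
    by have [] := vP i.
  by move=> j /v_inj <-.
apply/convex_setP => p q t t0 t1 [Pp Qp] [Pq Qq].
rewrite /C/= !linearD !linearZ/=; split; first by move/convex_setP: cP; exact.
move=> i e; have [_ ext] := vP i.
have [ep eq] := ext _ _ _ Pp Pq t0 t1 (esym e).
by have /convex_setP := cQ i; apply => //; [exact: Qp|exact: Qq].
Qed.

Lemma polytope_join_convex_body (R : realType) (d1 d2 n : nat)
    (v : 'I_n -> 'rV[R]_d1) (Q : 'I_n -> set 'rV[R]_d2) :
  (0 < n)%N -> (forall i, convex_body (Q i)) ->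
  convex_body (polytope_join v Q).
Proof.
move=> n0 bQ; split; last exact: convex_hull_convex.
  have [[q Qq] _ _] := bQ (Ordinal n0).
  exists (row_mx (v (Ordinal n0)) q); apply: sub_convex_hull.
  by exists (Ordinal n0) => //; exists q.
apply: compact_convex_hull_bigcup => [|i _|i _]; first exact: finite_finset.
  have [_ kQ _] := bQ i; apply: continuous_compact kQ.
  exact/continuous_subspaceT/row_mx_continuousr.
have [_ _ /convex_setP cQ] := bQ i.
apply/convex_setP => x y t t0 t1 [q Qq <-] [q' Qq' <-].
exists (t *: q + (1 - t) *: q'); first exact: cQ.
by rewrite !scale_row_mx add_row_mx -scalerDl subrKC scale1r.
Qed.

Lemma rsubmx_continuous (R : realType) (m d1 d2 : nat) :
  continuous (@rsubmx R m d1 d2).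
Proof.
apply: continuous_mx => i j.
by under eq_fun do rewrite mxE; exact: coord_continuous.
Qed.

(** * The minimality argument *)

Theorem proposition2p8 (R : realType) (d1 d2 n : nat)
    (P : set 'rV[R]_d1) (v : 'I_n -> 'rV[R]_d1) (Q : 'I_n -> set 'rV[R]_d2)
    (polyP : polytope P) (v_inj : injective v) (vP : vertices P = range v)
    (polyQ : forall i : 'I_n, polytope (Q i))
    (minP : minimal_covering P)
    (minQ : forall i : 'I_n, minimal_covering (Q i))
    (covPQ : covering (polytope_join v Q)) :
  minimal_covering (polytope_join v Q).
Proof.
have [[P0 kP cP] _ minimalP] := minP.
have bQ i : convex_body (Q i) by have [] := minQ i.
have vertex_v i : vertices P (v i) by rewrite vP; exists i.
(* With no vertices the join would be empty and could not cover 0. *)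
have n_gt0 : (0 < n)%N.
  rewrite lt0n; apply/eqP => n0; have [z] := (coveringP _).1 covPQ 0.
  apply: (convex_hull_sub (C := set0)); first exact/convex_setP.
  by move=> x [i _ _]; have := ltn_ord i; rewrite {2}n0.
split=> //; first exact: polytope_join_convex_body.
move=> K [K0 kK /convex_setP cK] [KJ JK] /coveringP covK.
have KPQ x y : K (row_mx x y) -> P x /\ forall i, x = v i -> Q i y.
  move=> /KJ; apply: polytope_join_sub => // i.
  by have [] := bQ i.
have closedK : closed K by apply: compact_closed kK; exact: norm_hausdorff.
(* If every [Q i] lay in the fibre of [K] over [v i], the convex set [K] would contain the whole
   join. *)
have [i QK] : exists i, ~ Q i `<=` [set y | K (row_mx (v i) y)].
  apply/existsNP => QK; apply: JK; apply: convex_hull_sub.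
    exact/convex_setP.
  by move=> x [i _ [q Qq <-]]; exact: QK Qq.
have [y0 Ky0] : exists y0, forall z : 'rV[int]_d2,
    ~ K (row_mx (v i) (y0 - map_mx intr z)).
  (* This fibre is compact and convex and lies strictly inside [Q i], so it would contradict the
     minimality of [Q i] if it were covering. *)
  pose F := [set y | K (row_mx (v i) y)].
  have FQ : F `<=` Q i by move=> y /KPQ[_]; exact.
  suff ncovF : ~ covering F.
    by have /existsNP[y0 Fy0] := ncovF \o (coveringP F).2; exists y0 => z Fz;
      apply: Fy0; exists z.
  move=> covF; have [_ _] := minQ i; apply; last exact: covF; last by split.
  split; first by have [z Fz] := (coveringP F).1 covF 0; exists (0 - map_mx intr z).
    apply: subclosed_compact FQ; last by have [] := bQ i.
    by apply: preimage_closed closedK => y _; exact: row_mx_continuousr.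
  apply/convex_setP => x y t t0 t1 Fx Fy; rewrite /F/=.
  have -> : v i = t *: v i + (1 - t) *: v i by rewrite -scalerDl subrKC scale1r.
  by rewrite -add_row_mx -!scale_row_mx; exact: cK.
pose S (z : 'rV[int]_d2) := [set x | K (row_mx x (y0 - map_mx intr z))].
have SP z : S z `<=` P by move=> x /KPQ[].
pose D := [set z | S z !=set0].
(* A non-empty slice puts [y0 - z] into the projection of [K] to the last coordinates, which is
   compact. *)
have finD : finite_set D.
  have kK2 : compact [set rsubmx p | p in K].
    by apply: continuous_compact kK; exact/continuous_subspaceT/rsubmx_continuous.
  apply: sub_finite_set (finite_lattice_translates y0 kK2) => z [x Sx].
  by exists (row_mx x (y0 - map_mx intr z)); rewrite ?row_mxKr.
pose P' := convex_hull (\bigcup_(z in D) S z).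
have P'P : P' `<=` P `\ v i.
  apply: convex_hull_sub; first exact: convex_setD1_vertex.
  by move=> x [z _ Sx]; split=> [|/= xv]; [exact: SP Sx|apply: (Ky0 z); rewrite -xv].
have covS x : exists z : 'rV[int]_d1, P' (x - map_mx intr z).
  (* The lattice vector moving [(x, y0)] into [K] splits in two: its right half selects the slice,
     its left half translates [x] into it. *)
  have [z Kz] := covK (row_mx x y0); exists (lsubmx z).
  have Sz : S (rsubmx z) (x - map_mx intr (lsubmx z)).
    rewrite /S/= -[row_mx _ _](_ : row_mx x y0 - map_mx intr z = _)//.
    by rewrite -[z in LHS]hsubmxK map_row_mx opp_row_mx add_row_mx.
  apply: sub_convex_hull; exists (rsubmx z) => //.
  by exists (x - map_mx intr (lsubmx z)).
apply: (minimalP P'); last exact/coveringP.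
  split; last exact: convex_hull_convex.
    by have [z P'z] := covS 0; exists (0 - map_mx intr z).
  apply: compact_convex_hull_bigcup => // z _.
    apply: subclosed_compact (SP z) => //.
    by apply: preimage_closed closedK => x _; exact: row_mx_continuousl.
  apply/convex_setP => x y t t0 t1 Sx Sy; rewrite /S/=.
  set w := y0 - _.
  (* Writing the height as a combination of itself keeps the segment inside one slice. *)
  have -> : w = t *: w + (1 - t) *: w by rewrite -scalerDl subrKC scale1r.
  by rewrite -add_row_mx -!scale_row_mx; exact: cK.
split; first by move=> x /P'P[].
by move=> /(_ (v i) (vertex_v i).1) /P'P[_]; exact.
Qed.
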